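(* Let $\Gamma$ be an abelian group, let $R,S$ be $\Gamma$-graded rings, and let $\phi:R\to S$ be a surjective graded homomorphism with $\ker\phi$ a gr-differential ideal. Then $\phi$ induces $$\phi_*:\mathfrak{Der}^{gh}_\Gamma(R)\to\mathfrak{Der}^{gh}_\Gamma(S),$$ defined by $\phi_*((F_R,d_R)_h)=(F_S,d_S)_h$, where $F_S(\phi(r))=\phi(F_R(r))$ and $d_S(\phi(r))=\phi(d_R(r))$.
   Context: A ring $R$ is $\Gamma$-graded if $R=\bigoplus_{\tau\in\Gamma}R_\tau$ as additive groups with $R_\tau R_\sigma\subseteq R_{\tau\sigma}$ for all $\tau,\sigma\in\Gamma$; $\mathcal{H}(R)=\bigcup_{\tau\in\Gamma}R_\tau$ is the set of homogeneous elements. A ring homomorphism $\phi:R\to S$ of $\Gamma$-graded rings is graded if $\phi(R_\tau)\subseteq S_\tau$ for all $\tau\in\Gamma$. A homogeneous derivation of $R$ is an additive map $d:R\to R$ with $d(xy)=d(x)y+xd(y)$ for all $x,y\in R$ and $d(\mathcal{H}(R))\subseteq\mathcal{H}(R)$. A generalized homogeneous derivation of $R$, written $(F,d)_h$, is an additive map $F:R\to R$ together with an associated homogeneous derivation $d$ of $R$ such that $F(xy)=F(x)y+xd(y)$ for all $x,y\in R$ and $F(\mathcal{H}(R))\subseteq\mathcal{H}(R)$; $\mathfrak{Der}^{gh}_\Gamma(R)$ denotes the collection of all of them. Given a generalized homogeneous derivation $(F,d)_h$ of $R$, a graded ideal $\mathfrak{a}\subseteq R$ (i.e. $\mathfrak{a}=\bigoplus_{\tau\in\Gamma}(\mathfrak{a}\cap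 R_\tau)$) is called gr-differential (with respect to $(F,d)_h$) if $d(\mathfrak{a})\subseteq\mathfrak{a}$ and $F(\mathfrak{a})\subseteq\mathfrak{a}$. *)

(* Defs.v *)
From HB Require Import structures.
From mathcomp Require Import all_boot all_order all_algebra finmap.

Set Implicit Arguments.
Unset Strict Implicit.
Unset Printing Implicit Defensive.

Import GRing.Theory.

Local Open Scope ring_scope.

(* The grading group is abelian and hence written additively (zmodType).
   Rings are associative and unital, not necessarily commutative, and the zero
   ring is allowed (pzRingType).  The index set may be infinite, so an element
   of a direct sum is a finitely supported family. *)

Definition is_direct_sum (G : zmodType) (V : zmodType)
    (A : {pred V}) (B : G -> {pred V}) : Prop :=
  [/\ forall t, zmod_closed (B t),
      forall t, {subset B t <= A} &
      forall x, x \in A ->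
        exists! f : {fsfun G -> V with 0},
          (forall t, f t \in B t) /\ x = \sum_(t <- finsupp f) f t].

Record grading (G : zmodType) (R : pzRingType) := Grading {
  gr_part :> G -> {pred R};
  gr_direct_sum : is_direct_sum predT gr_part;
  gr_mul : forall (t s : G) (x y : R),
    x \in gr_part t -> y \in gr_part s -> x * y \in gr_part (t + s)
}.

Definition homogeneous (G : zmodType) (R : pzRingType) (gR : grading G R)
    (x : R) : Prop :=
  exists t : G, x \in gR t.

Definition graded_morphism (G : zmodType) (R S : pzRingType)
    (gR : grading G R) (gS : grading G S) (phi : {rmorphism R -> S}) : Prop :=
  forall (t : G) (x : R), x \in gR t -> phi x \in gS t.

Record hom_derivation (G : zmodType) (R : pzRingType) (gR : grading G R) :=
  HomDerivation {
    hd_fun :> {additive R -> R};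
    hd_leibniz : forall x y, hd_fun (x * y) = hd_fun x * y + x * hd_fun y;
    hd_homogeneous : forall x, homogeneous gR x -> homogeneous gR (hd_fun x)
  }.

Record gh_derivation (G : zmodType) (R : pzRingType) (gR : grading G R) :=
  GHDerivation {
    gh_fun : {additive R -> R};
    gh_der : hom_derivation gR;
    gh_leibniz : forall x y, gh_fun (x * y) = gh_fun x * y + x * gh_der y;
    gh_homogeneous : forall x, homogeneous gR x -> homogeneous gR (gh_fun x)
  }.

(* The library's idealr_closed is one-sided and excludes the unit ideal. *)
Definition two_sided_ideal (R : pzRingType) (a : {pred R}) : Prop :=
  zmod_closed a /\
  forall r x : R, x \in a -> r * x \in a /\ x * r \in a.

Definition graded_ideal (G : zmodType) (R : pzRingType) (gR : grading G R)
    (a : {pred R}) : Prop :=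
  two_sided_ideal a /\ is_direct_sum a (fun t => [predI a & gR t]).

Definition gr_differential (G : zmodType) (R : pzRingType) (gR : grading G R)
    (D : gh_derivation gR) (a : {pred R}) : Prop :=
  [/\ graded_ideal gR a,
      forall x, x \in a -> gh_der D x \in a &
      forall x, x \in a -> gh_fun D x \in a].

Definition ker_pred (R S : pzRingType) (phi : {rmorphism R -> S}) : {pred R} :=
  [pred x | phi x == 0].

Definition induced_by (G : zmodType) (R S : pzRingType)
    (gR : grading G R) (gS : grading G S) (phi : {rmorphism R -> S})
    (DR : gh_derivation gR) (DS : gh_derivation gS) : Prop :=
  forall r : R, gh_fun DS (phi r) = phi (gh_fun DR r) /\
                gh_der DS (phi r) = phi (gh_der DR r).

(* Main.v *)
Require Import Defs.
From HB Require Import structures.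
From mathcomp Require Import all_boot all_order all_algebra finmap.
From mathcomp Require Import boolp.

(** An additive map of [R] that preserves [ker phi] becomes an additive map of
[S = R / ker phi] ([additive_descent]), uniquely since [phi] is surjective, and
the Leibniz rules pass to the quotient because every element of [S] is of the
form [phi r].  The one point that uses the gradings is that the induced maps
preserve homogeneous elements: for this a homogeneous element of [S] must have
a homogeneous preimage ([homogeneous_lift]), which then can be moved through
the homogeneous map of [R] and back to [S] by [phi].  A preimage is obtained by
taking any preimage and keeping only its component of the right degree; the
uniqueness of homogeneous decompositions in [S] shows that the other components
are sent to zero.

The uniqueness claims are equalities between records carrying proofs; they
follow from the agreement of the underlying functions by function
extensionality and proof irrelevance ([gh_derivation_ext]). *)

Set Implicit Arguments.
Unset Strict Implicit.
Unset Printing Implicit Defensive.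

Import GRing.Theory.

Local Open Scope ring_scope.

Lemma additive_ext (U V : zmodType) (f g : {additive U -> V}) : f =1 g -> f = g.
Proof.
case: f g => [f [[[f0 fD]]]] [g [[[g0 gD]]]] /= /funext fg.
case: g / fg g0 gD => g0 gD.
by rewrite (Prop_irrelevance f0 g0) (Prop_irrelevance fD gD).
Qed.

Lemma hom_derivation_ext (G : zmodType) (R : pzRingType) (gR : grading G R)
  (d e : hom_derivation gR) : d =1 e -> d = e.
Proof.
case: d e => [d dL dH] [e eL eH] /= /additive_ext de.
case: e / de eL eH => eL eH.
by rewrite (Prop_irrelevance dL eL) (Prop_irrelevance dH eH).
Qed.

Lemma gh_derivation_ext (G : zmodType) (R : pzRingType) (gR : grading G R)
    (D E : gh_derivation gR) :
  gh_fun D =1 gh_fun E -> gh_der D =1 gh_der E -> D = E.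
Proof.
case: D E => [F d FL FH] [F' e FL' FH'] /= /additive_ext FF'.
move=> /hom_derivation_ext de.
case: F' / FF' FL' FH' => FL' FH'.
case: e / de FL' => FL'.
by rewrite (Prop_irrelevance FL FL') (Prop_irrelevance FH FH').
Qed.

(** The preimage is the component of degree [t] of an arbitrary preimage [r] of
[s]: the images of the components of [r] form a homogeneous decomposition of
[s], and so does the family with the single entry [s] in degree [t]. *)
Lemma homogeneous_lift (G : zmodType) (R S : pzRingType)
    (gR : grading G R) (gS : grading G S) (phi : {rmorphism R -> S})
    (phi_graded : graded_morphism gR gS phi)
    (phi_surj : forall s : S, exists r : R, phi r = s) (t : G) (s : S) :
  s \in gS t -> exists2 r, r \in gR t & phi r = s.
Proof.
move=> st; have [r phi_r] := phi_surj s.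
have [_ _ /(_ r isT) [f [[fP r_sum] _]]] := gr_direct_sum gR.
have [closedS _ /(_ s isT) [h [_ h_uniq]]] := gr_direct_sum gS.
exists (f t) => //.
pose g : {fsfun G -> S with 0} := [fsfun u in finsupp f => phi (f u) | 0]%fset.
have gE u : g u = phi (f u).
  by rewrite fsfunE; case: finsuppP => // _; rewrite raddf0.
have hg : h = g.
  apply: h_uniq; split=> [u|]; first by rewrite gE; apply: phi_graded.
  rewrite -phi_r r_sum raddf_sum /=.
  (* [phi] may kill components of [r], so [finsupp g] can be smaller than
     [finsupp f]; the extra terms vanish. *)
  rewrite (big_fset_incl _ (finsupp_sub _ _ _)) => [|u _]; last first.
    by rewrite memNfinsupp => /eqP.
  by apply: eq_bigr => u _; rewrite gE.
pose e : {fsfun G -> S with 0} := [fsfun u in [fset t] => s | 0]%fset.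
have eE u : e u = if u == t then s else 0 by rewrite fsfunE inE.
have he : h = e.
  apply: h_uniq; split=> [u|].
    by rewrite eE; case: eqP => [-> //|_]; case: (closedS u).
  (* As [s] may be zero, [finsupp e] is only contained in [{t}]. *)
  rewrite (big_fset_incl _ (finsupp_sub _ _ _)) => [|u _]; last first.
    by rewrite memNfinsupp => /eqP.
  by rewrite big_seq_fset1 eE eqxx.
by rewrite -gE -hg he eE eqxx.
Qed.

(** The factor theorem for additive groups, with the factor as data.  It is [h]
after a set-theoretic section of [phi], which exists constructively because
equality in [V] is decidable and [U] has a choice operator. *)
Lemma additive_descent (U V W : zmodType) (phi : {additive U -> V})
    (phi_surj : forall v, exists u, phi u = v) (h : {additive U -> W}) :
    (forall u, phi u = 0 -> h u = 0) ->
  {k : {additive V -> W} | forall u, k (phi u) = h u}.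
Proof.
move=> h_ker.
have surjb v : exists u, phi u == v by have [u <-] := phi_surj v; exists u.
pose lift v := xchoose (surjb v).
have liftK v : phi (lift v) = v by apply/eqP/(xchooseP (surjb v)).
pose k v := h (lift v).
have kE u : k (phi u) = h u.
  apply/eqP; rewrite -subr_eq0 -raddfB h_ker //.
  by rewrite raddfB liftK subrr.
have kB : zmod_morphism k.
  by move=> x y; rewrite -(liftK x) -(liftK y) -raddfB !kE raddfB.
pose kM := GRing.isZmodMorphism.Build V W k kB.
pose kA : {additive V -> W} := HB.pack k kM.
by exists kA.
Qed.

(** The conclusion is a sigma type, so that the induced derivations for all
[DR] assemble into a function. *)
Lemma gh_derivation_descent (G : zmodType) (R S : pzRingType)
    (gR : grading G R) (gS : grading G S) (phi : {rmorphism R -> S})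
    (phi_graded : graded_morphism gR gS phi)
    (phi_surj : forall s : S, exists r : R, phi r = s)
    (DR : gh_derivation gR) :
  gr_differential DR (ker_pred phi) ->
  {DS : gh_derivation gS | induced_by phi DR DS}.
Proof.
case=> _ d_ker F_ker.
have ker_comp (h : {additive R -> R}) :
    (forall x, x \in ker_pred phi -> h x \in ker_pred phi) ->
  forall x, phi x = 0 -> (phi \o h) x = 0.
  by move=> h_ker x /eqP /h_ker /eqP.
have [d dE] := additive_descent phi_surj (ker_comp (gh_der DR) d_ker).
have [F FE] := additive_descent phi_surj (ker_comp (gh_fun DR) F_ker).
rewrite /= in dE FE.
have dL x y : d (x * y) = d x * y + x * d y.
  have [[r <-] [q <-]] := (phi_surj x, phi_surj y).
  by rewrite -rmorphM !dE hd_leibniz rmorphD !rmorphM.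
have FL x y : F (x * y) = F x * y + x * d y.
  have [[r <-] [q <-]] := (phi_surj x, phi_surj y).
  by rewrite -rmorphM !FE !dE gh_leibniz rmorphD !rmorphM.
have phiH r : homogeneous gR r -> homogeneous gS (phi r).
  by case=> t rt; exists t; apply: phi_graded.
have liftH s : homogeneous gS s -> exists2 r, homogeneous gR r & phi r = s.
  case=> t /(homogeneous_lift phi_graded phi_surj) [r rt <-].
  by exists r => //; exists t.
have dH x : homogeneous gS x -> homogeneous gS (d x).
  by case/liftH=> r rH <-; rewrite dE; apply/phiH/hd_homogeneous.
have FH x : homogeneous gS x -> homogeneous gS (F x).
  by case/liftH=> r rH <-; rewrite FE; apply/phiH/gh_homogeneous.
by exists (@GHDerivation _ _ _ F (HomDerivation dL dH) FL FH).
Qed.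

Lemma induced_by_uniq (G : zmodType) (R S : pzRingType)
    (gR : grading G R) (gS : grading G S) (phi : {rmorphism R -> S})
    (phi_surj : forall s : S, exists r : R, phi r = s)
    (DR : gh_derivation gR) (DS DS' : gh_derivation gS) :
  induced_by phi DR DS -> induced_by phi DR DS' -> DS = DS'.
Proof.
move=> DSE DSE'; apply: gh_derivation_ext => s; have [r <-] := phi_surj s;
by have [FE dE] := DSE r; have [FE' dE'] := DSE' r; rewrite ?FE ?dE.
Qed.

Theorem proposition3p2 (G : zmodType) (R S : pzRingType)
    (gR : grading G R) (gS : grading G S) (phi : {rmorphism R -> S})
    (phi_graded : graded_morphism gR gS phi)
    (phi_surj : forall s : S, exists r : R, phi r = s) :
  (forall DR : gh_derivation gR, gr_differential DR (ker_pred phi) ->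
     exists! DS : gh_derivation gS, induced_by phi DR DS) /\
  ((forall DR : gh_derivation gR, gr_differential DR (ker_pred phi)) ->
     exists! phi_star : gh_derivation gR -> gh_derivation gS,
       forall DR : gh_derivation gR, induced_by phi DR (phi_star DR)).
Proof.
pose descent DR := @gh_derivation_descent _ _ _ _ _ _ phi_graded phi_surj DR.
split=> [DR /descent [DS DSE]|ker_diff].
  by exists DS; split=> // DS'; apply: (induced_by_uniq phi_surj DSE).
exists (fun DR => sval (descent DR (ker_diff DR))).
split=> [DR|phi_star phi_starE]; first exact: svalP.
apply/funext => DR.
exact: (induced_by_uniq phi_surj (svalP (descent DR _)) (phi_starE DR)).
Qed.
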